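(* Let $\mathbf H=(\underline H,\overline H,\omega)$ be a weak (monad-comonad) entwining on a Cauchy complete category $\mathbb A$ and $\mathbf T$ the monad it induces on $\mathbb A^{\overline H}$. Then there is an isomorphism of categories $$\Phi':\mathbb A^{\overline H}_{\underline H}(\omega)\to(\mathbb A^{\overline H})_{\mathbf T},\qquad (a,h,\theta)\mapsto\big((a,\theta),\,h\cdot i'_{(a,\theta)}\big),$$ with inverse given by $(\Phi')^{-1}((a,\theta),g)=(a,\,g\cdot p'_{(a,\theta)},\,\theta)$.
   Context: $\cdot$ is vertical composition of natural transformations and juxtaposition is composition of functors and whiskering. Cauchy complete means every idempotent splits. $\mathbb A_{\underline H}$, $\mathbb A^{\overline H}$ are the Eilenberg–Moore categories of modules of the monad $\underline H$ and comodules of the comonad $\overline H$; $(\mathbb A^{\overline H})_{\mathbf T}$ is the category of $\mathbf T$-modules in $\mathbb A^{\overline H}$. Weak entwining. Let $\underline H=(H,m,e)$ be a monad and $\overline H=(H,\delta,\varepsilon)$ a comonad on $\mathbb A$ with the same endofunctor $H$. For $\omega:HH\to HH$ put $\xi:=\varepsilon H\cdot\omega\cdot eH:H\to H$. $(\underline H,\overline H,\omega)$ is a weak entwining if (i) $\omega\cdot mH=Hm\cdot\omega H\cdot H\omega$ and $\delta H\cdot\omega=H\omega\cdot\omega H\cdot H\delta$; (ii) $\omega\cdot eH=H\xi\cdot\delta$ and $\varepsilon H\cdot\omega=m\cdot H\xi$. Mixed bimodules. $\mathbb A^{\overline H}_{\underline H}(\omega)$ has as objects triples $(a,h,\theta)$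 with $(a,h)\in\mathbb A_{\underline H}$, $(a,\theta)\in\mathbb A^{\overline H}$ and $\theta\cdot h=H(h)\cdot\omega_a\cdot H(\theta)$; morphisms are morphisms of $\mathbb A$ that are both $\underline H$-module and $\overline H$-comodule morphisms. Induced monad $\mathbf T$. For $(a,\theta)\in\mathbb A^{\overline H}$ the morphism $\Gamma'_{(a,\theta)}:=\varepsilon_{H(a)}\cdot\omega_a\cdot H(\theta):H(a)\to H(a)$ is a natural idempotent; let $\Gamma'=i'\cdot p'$, $p'\cdot i'=1$, with $p'_{(a,\theta)}:H(a)\to T(a,\theta)$, $i'_{(a,\theta)}:T(a,\theta)\to H(a)$, be a splitting. The functor part of $\mathbf T$ sends $(a,\theta)$ to $T(a,\theta)$ with comodule structure $H(p'_{(a,\theta)})\cdot\omega_a\cdot H(\theta)\cdot i'_{(a,\theta)}:T(a,\theta)\to HT(a,\theta)$; its multiplication is $TT(a,\theta)\xrightarrow{i'_{T(a,\theta)}}HT(a,\theta)\xrightarrow{H(i'_{(a,\theta)})}HH(a)\xrightarrow{m_a}H(a)\xrightarrow{p'_{(a,\theta)}}T(a,\theta)$ and its unit is $p'_{(a,\theta)}\cdot\theta:a\to T(a,\theta)$.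
   Formalization: The unit of the induced monad T is taken to be p'·e_a instead of p'·θ: with p'·θ the unit law fails in general (e.g. H = G×− on Set for a group G), and p'·e_a is the only unit compatible with the given multiplication. *)

(* Defs.v *)
(* Plain Rocq with the ssreflect tactics and the Stdlib classical axioms;
   categories are developed from scratch, with Leibniz equality on morphisms. *)
From Stdlib Require Import ssreflect.
From Stdlib Require Import ProofIrrelevance FunctionalExtensionality.
From Stdlib Require Import ClassicalEpsilon.

Set Implicit Arguments.
Unset Strict Implicit.
Unset Printing Implicit Defensive.

Declare Scope cat_scope.
Delimit Scope cat_scope with cat.
Open Scope cat_scope.

(** * Categories, functors, natural transformations *)

Record category := Category {
  ob :> Type;
  hom : ob -> ob -> Type;
  idm : forall a, hom a a;
  comp : forall a b c, hom b c -> hom a b -> hom a c;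
  compA : forall a b c d (h : hom c d) (g : hom b c) (f : hom a b),
    comp (comp h g) f = comp h (comp g f);
  comp1m : forall a b (f : hom a b), comp (idm b) f = f;
  compm1 : forall a b (f : hom a b), comp f (idm a) = f
}.
Arguments hom {A} a b : rename.
Arguments idm {A} a : rename.
Arguments comp {A a b c} g f : rename.
Arguments compA {A a b c d} h g f : rename.
Arguments comp1m {A a b} f : rename.
Arguments compm1 {A a b} f : rename.

Notation "g ∘ f" := (comp g f) (at level 41, right associativity) : cat_scope.

Record functor (A B : category) := Functor {
  fob :> A -> B;
  fmap : forall a b, hom a b -> hom (fob a) (fob b);
  fmap1 : forall a, fmap (idm a) = idm (fob a);
  fmapM : forall a b c (g : hom b c) (f : hom a b),
    fmap (g ∘ f) = fmap g ∘ fmap f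
}.
Arguments fmap {A B} F {a b} f : rename.
Arguments fmap1 {A B} F a : rename.
Arguments fmapM {A B} F {a b c} g f : rename.

Definition id_functor (A : category) : functor A A :=
  @Functor A A (fun a => a) (fun a b f => f)
    (fun a => eq_refl) (fun a b c g f => eq_refl).

Definition comp_functor (A B C : category) (F : functor B C) (G : functor A B) :
  functor A C.
Proof.
refine (@Functor A C (fun a => F (G a)) (fun a b f => fmap F (fmap G f)) _ _).
- abstract (by move=> a; rewrite !fmap1).
- abstract (by move=> a b c g f; rewrite !fmapM).
Defined.

Notation "F ⊙ G" := (comp_functor F G) (at level 40, left associativity) :
  cat_scope.

Record nat_trans (A B : category) (F G : functor A B) := NatTrans {
  component :> forall a, hom (F a) (G a);
  naturality : forall a b (f : hom a b),
    component b ∘ fmap F f = fmap G f ∘ component a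
}.
Arguments naturality {A B F G} n {a b} f : rename.

Definition inverse_functors (A B : category) (F : functor A B)
    (G : functor B A) : Prop :=
  G ⊙ F = id_functor A /\ F ⊙ G = id_functor B.

Definition cauchy_complete (A : category) : Prop :=
  forall (a : A) (f : hom a a), f ∘ f = f ->
  exists (b : A) (p : hom a b) (i : hom b a), i ∘ p = f /\ p ∘ i = idm b.

(** * Monads, comonads and their Eilenberg-Moore categories *)

Record monad (A : category) (H : functor A A) := Monad {
  mult : nat_trans (H ⊙ H) H;
  unit : nat_trans (id_functor A) H;
  multA : forall a, mult a ∘ fmap H (mult a) = mult a ∘ mult (H a);
  mult1m : forall a, mult a ∘ unit (H a) = idm (H a);
  multm1 : forall a, mult a ∘ fmap H (unit a) = idm (H a)
}.

Record comonad (A : category) (H : functor A A) := Comonad {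
  comult : nat_trans H (H ⊙ H);
  counit : nat_trans H (id_functor A);
  comultA : forall a,
    fmap H (comult a) ∘ comult a = comult (H a) ∘ comult a;
  comult1m : forall a, counit (H a) ∘ comult a = idm (H a);
  comultm1 : forall a, fmap H (counit a) ∘ comult a = idm (H a)
}.

Lemma monad_unit_unique (A : category) (H : functor A A) (M N : monad H) :
  (forall a, mult M a = mult N a) -> forall a, unit M a = unit N a.
Proof.
move=> eqm a; rewrite -[unit M a]comp1m -(mult1m N a) -eqm compA.
have /= -> := naturality (unit N) (unit M a).
by rewrite -compA multm1; apply: comp1m.
Qed.

Lemma sig_hom_eq (A : category) (a b : A) (P : hom a b -> Prop)
  (f g : {f : hom a b | P f}) : proj1_sig f = proj1_sig g -> f = g.
Proof.
case: f g => [f Pf] [g Pg] /= e; move: Pf; rewrite e => Pf.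
by rewrite (proof_irrelevance _ Pf Pg).
Qed.

Section EilenbergMoore.

Context (A : category) (H : functor A A).

Record is_module (M : monad H) (a : A) (h : hom (H a) a) : Prop := IsModule {
  module_assoc : h ∘ fmap H h = h ∘ mult M a;
  module_unit : h ∘ unit M a = idm a
}.

Record is_comodule (G : comonad H) (a : A) (t : hom a (H a)) : Prop :=
  IsComodule {
  comodule_coassoc : fmap H t ∘ t = comult G a ∘ t;
  comodule_counit : counit G a ∘ t = idm a
}.

Definition is_module_hom (a b : A) (h : hom (H a) a) (k : hom (H b) b)
  (f : hom a b) : Prop := f ∘ h = k ∘ fmap H f.

Definition is_comodule_hom (a b : A) (t : hom a (H a)) (s : hom b (H b))
  (f : hom a b) : Prop := s ∘ f = fmap H f ∘ t.

Lemma is_module_hom1 a (h : hom (H a) a) : is_module_hom h h (idm a).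
Proof. by rewrite /is_module_hom fmap1 comp1m compm1. Qed.

Lemma is_module_homM a b c (h : hom (H a) a) (k : hom (H b) b)
    (l : hom (H c) c) (g : hom b c) (f : hom a b) :
  is_module_hom k l g -> is_module_hom h k f -> is_module_hom h l (g ∘ f).
Proof.
by rewrite /is_module_hom fmapM => eg ef; rewrite compA ef -!compA eg.
Qed.

Lemma is_comodule_hom1 a (t : hom a (H a)) : is_comodule_hom t t (idm a).
Proof. by rewrite /is_comodule_hom fmap1 comp1m compm1. Qed.

Lemma is_comodule_homM a b c (t : hom a (H a)) (s : hom b (H b))
    (r : hom c (H c)) (g : hom b c) (f : hom a b) :
  is_comodule_hom s r g -> is_comodule_hom t s f ->
  is_comodule_hom t r (g ∘ f).
Proof.
by rewrite /is_comodule_hom fmapM => eg ef; rewrite compA -ef -!compA eg.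
Qed.

Record module_ob (M : monad H) := mk_module {
  mod_carrier : A;
  action : hom (H mod_carrier) mod_carrier;
  moduleP : is_module M action
}.

Record comodule_ob (G : comonad H) := mk_comodule {
  comod_carrier : A;
  coaction : hom comod_carrier (H comod_carrier);
  comoduleP : is_comodule G coaction
}.

Definition module_hom (M : monad H) (x y : module_ob M) : Type :=
  {f : hom (mod_carrier x) (mod_carrier y)
     | is_module_hom (action x) (action y) f}.

Definition comodule_hom (G : comonad H) (x y : comodule_ob G) : Type :=
  {f : hom (comod_carrier x) (comod_carrier y)
     | is_comodule_hom (coaction x) (coaction y) f}.

Definition modules (M : monad H) : category.
Proof.
refine (@Category (module_ob M) (@module_hom M)
  (fun x => exist _ (idm (mod_carrier x)) (is_module_hom1 _))
  (fun x y z g f => exist _ (proj1_sig g ∘ proj1_sig f)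
     (is_module_homM (proj2_sig g) (proj2_sig f))) _ _ _).
- abstract (by move=> *; apply: sig_hom_eq; apply: compA).
- abstract (by move=> *; apply: sig_hom_eq; apply: comp1m).
- abstract (by move=> *; apply: sig_hom_eq; apply: compm1).
Defined.

Definition comodules (G : comonad H) : category.
Proof.
refine (@Category (comodule_ob G) (@comodule_hom G)
  (fun x => exist _ (idm (comod_carrier x)) (is_comodule_hom1 _))
  (fun x y z g f => exist _ (proj1_sig g ∘ proj1_sig f)
     (is_comodule_homM (proj2_sig g) (proj2_sig f))) _ _ _).
- abstract (by move=> *; apply: sig_hom_eq; apply: compA).
- abstract (by move=> *; apply: sig_hom_eq; apply: comp1m).
- abstract (by move=> *; apply: sig_hom_eq; apply: compm1).
Defined.

Definition modules_forget (M : monad H) : functor (modules M) A :=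
  @Functor (modules M) A (@mod_carrier M) (fun x y f => proj1_sig f)
    (fun x => eq_refl) (fun x y z g f => eq_refl).

End EilenbergMoore.

Arguments mk_module {A H M} mod_carrier action moduleP.
Arguments mk_comodule {A H G} comod_carrier coaction comoduleP.

(** * Weak entwinings and mixed bimodules *)

Section WeakEntwining.

Context (A : category) (H : functor A A) (M : monad H) (G : comonad H).
Context (omega : nat_trans (H ⊙ H) (H ⊙ H)).

Definition xi (a : A) : hom (H a) (H a) :=
  counit G (H a) ∘ omega a ∘ unit M (H a).

Record weak_entwining : Prop := WeakEntwining {
  entw_mult : forall a,
    omega a ∘ mult M (H a) =
    fmap H (mult M a) ∘ omega (H a) ∘ fmap H (omega a);
  entw_comult : forall a,
    comult G (H a) ∘ omega a =
    fmap H (omega a) ∘ omega (H a) ∘ fmap H (comult G a);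
  entw_unit : forall a,
    omega a ∘ unit M (H a) = fmap H (xi a) ∘ comult G a;
  entw_counit : forall a,
    counit G (H a) ∘ omega a = mult M a ∘ fmap H (xi a)
}.

Definition is_mixed (a : A) (h : hom (H a) a) (t : hom a (H a)) : Prop :=
  t ∘ h = fmap H h ∘ omega a ∘ fmap H t.

Record mixed_ob := mk_mixed {
  mix_carrier : A;
  mix_action : hom (H mix_carrier) mix_carrier;
  mix_coaction : hom mix_carrier (H mix_carrier);
  mix_moduleP : is_module M mix_action;
  mix_comoduleP : is_comodule G mix_coaction;
  mixedP : is_mixed mix_action mix_coaction
}.

Definition mixed_hom (x y : mixed_ob) : Type :=
  {f : hom (mix_carrier x) (mix_carrier y)
     | is_module_hom (mix_action x) (mix_action y) f /\
       is_comodule_hom (mix_coaction x) (mix_coaction y) f}.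

Definition mixed_bimodules : category.
Proof.
refine (@Category mixed_ob mixed_hom
  (fun x => exist _ (idm (mix_carrier x))
     (conj (is_module_hom1 _) (is_comodule_hom1 _)))
  (fun x y z g f => exist _ (proj1_sig g ∘ proj1_sig f)
     (conj (is_module_homM (proj1 (proj2_sig g)) (proj1 (proj2_sig f)))
           (is_comodule_homM (proj2 (proj2_sig g)) (proj2 (proj2_sig f)))))
  _ _ _).
- abstract (by move=> *; apply: sig_hom_eq; apply: compA).
- abstract (by move=> *; apply: sig_hom_eq; apply: comp1m).
- abstract (by move=> *; apply: sig_hom_eq; apply: compm1).
Defined.

Definition mix_comodule (x : mixed_ob) : comodule_ob G :=
  mk_comodule (mix_carrier x) (mix_coaction x) (mix_comoduleP x).

Definition mixed_forget : functor mixed_bimodules (comodules G).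
Proof.
refine (@Functor mixed_bimodules (comodules G) mix_comodule
  (fun x y f => exist _ (proj1_sig f) (proj2 (proj2_sig f))) _ _).
- abstract (by move=> *; apply: sig_hom_eq).
- abstract (by move=> *; apply: sig_hom_eq).
Defined.

(** * The idempotent [Gamma'] and the induced monad *)

Definition Gamma (x : comodule_ob G) :
    hom (H (comod_carrier x)) (H (comod_carrier x)) :=
  counit G (H (comod_carrier x)) ∘ omega (comod_carrier x)
    ∘ fmap H (coaction x).

(* A choice of splittings; one exists when [A] is Cauchy complete, see
   [Gamma_splitting_exists] below. *)
Record Gamma_splitting := GammaSplitting {
  spl_ob : comodule_ob G -> A;
  spl_p : forall x, hom (H (comod_carrier x)) (spl_ob x);
  spl_i : forall x, hom (spl_ob x) (H (comod_carrier x));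
  spl_ip : forall x, spl_i x ∘ spl_p x = Gamma x;
  spl_pi : forall x, spl_p x ∘ spl_i x = idm (spl_ob x)
}.

End WeakEntwining.

Arguments mk_mixed {A H M G omega} mix_carrier mix_action mix_coaction
  mix_moduleP mix_comoduleP mixedP.

Lemma cancel21 (A : category) (a b c d : A) (g : hom b c) (f : hom a b)
  (k : hom a c) (w : hom d a) : g ∘ f = k -> g ∘ f ∘ w = k ∘ w.
Proof. by move=> <-; rewrite compA. Qed.

Lemma cancel22 (A : category) (a b b' c d : A) (g : hom b c) (f : hom a b)
  (g' : hom b' c) (f' : hom a b') (w : hom d a) :
  g ∘ f = g' ∘ f' -> g ∘ f ∘ w = g' ∘ f' ∘ w.
Proof. by move=> e; rewrite -!compA e. Qed.

Lemma fmapMw (A B : category) (F : functor A B) (a b c : A) (d : B)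
  (g : hom b c) (f : hom a b) (w : hom d (F a)) :
  fmap F g ∘ fmap F f ∘ w = fmap F (g ∘ f) ∘ w.
Proof. by rewrite fmapM compA. Qed.

Section InducedMonad.

Context (A : category) (H : functor A A) (M : monad H) (G : comonad H).
Context (omega : nat_trans (H ⊙ H) (H ⊙ H)).
Context (W : weak_entwining M G omega).

Local Notation U := (@comod_carrier A H G).
Local Notation co := coaction.
Local Notation Gam := (@Gamma A H G omega).
Local Notation mu := (mult M).
Local Notation et := (unit M).
Local Notation dl := (comult G).
Local Notation ep := (counit G).

Lemma mN a b (f : hom a b) : mu b ∘ fmap H (fmap H f) = fmap H f ∘ mu a.
Proof. exact: (naturality mu f). Qed.

Lemma eN a b (f : hom a b) : et b ∘ f = fmap H f ∘ et a.
Proof. exact: (naturality et f). Qed.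

Lemma dN a b (f : hom a b) : dl b ∘ fmap H f = fmap H (fmap H f) ∘ dl a.
Proof. exact: (naturality dl f). Qed.

Lemma epN a b (f : hom a b) : ep b ∘ fmap H f = f ∘ ep a.
Proof. exact: (naturality ep f). Qed.

Lemma oN a b (f : hom a b) :
  omega b ∘ fmap H (fmap H f) = fmap H (fmap H f) ∘ omega a.
Proof. exact: (naturality omega f). Qed.

(* The coassociative, in general not counital, coaction on [H a]. *)
Definition wcoact (a : A) (t : hom a (H a)) : hom (H a) (H (H a)) :=
  omega a ∘ fmap H t.

Definition wGamma (a : A) (t : hom a (H a)) : hom (H a) (H a) :=
  ep (H a) ∘ wcoact t.

Definition coassoc (a : A) (t : hom a (H a)) : Prop :=
  fmap H t ∘ t = dl a ∘ t.

Lemma wcoact_coassoc a (t : hom a (H a)) : coassoc t -> coassoc (wcoact t).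
Proof.
rewrite /coassoc /wcoact => ct.
rewrite (cancel22 _ (entw_comult W a)) !compA -fmapM -ct !fmapM.
by rewrite (cancel22 _ (oN t)) ?compA.
Qed.

Lemma wGamma_wcoact a (t : hom a (H a)) :
  coassoc t -> fmap H (wGamma t) ∘ wcoact t = wcoact t.
Proof.
move=> h; have ct := wcoact_coassoc h; rewrite /wGamma fmapM ?compA ct.
by rewrite (cancel21 _ (comultm1 G _)) comp1m.
Qed.

Lemma wcoact_wGamma a (t : hom a (H a)) :
  coassoc t -> wcoact t ∘ wGamma t = wcoact t.
Proof.
move=> h; have ct := wcoact_coassoc h; rewrite /wGamma -(cancel22 _ (epN _)) ct.
by rewrite (cancel21 _ (comult1m G _)) comp1m.
Qed.

Lemma wGamma_idem a (t : hom a (H a)) :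
  coassoc t -> wGamma t ∘ wGamma t = wGamma t.
Proof.
by move=> ct; rewrite {1}/wGamma compA wcoact_wGamma.
Qed.

Lemma wGammaM a b (t : hom a (H a)) (s : hom b (H b)) (f : hom a b) :
  is_comodule_hom t s f ->
  wGamma s ∘ fmap H f = fmap H f ∘ wGamma t.
Proof.
rewrite /is_comodule_hom /wGamma /wcoact => ef.
rewrite !compA -fmapM ef fmapM (cancel22 _ (oN f)).
by rewrite (cancel22 _ (epN _)) ?compA.
Qed.

Lemma wcoactM a b (t : hom a (H a)) (s : hom b (H b)) (f : hom a b) :
  is_comodule_hom t s f -> is_comodule_hom (wcoact t) (wcoact s) (fmap H f).
Proof.
rewrite /is_comodule_hom /wcoact => ef.
by rewrite !compA -fmapM ef fmapM (cancel22 _ (oN f)) ?compA.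
Qed.

Lemma wcoact_mult a (t : hom a (H a)) :
  is_comodule_hom (wcoact (wcoact t)) (wcoact t) (mu a).
Proof.
rewrite /is_comodule_hom /wcoact !compA -(mN t).
by rewrite (cancel22 _ (entw_mult W a)) fmapM !compA.
Qed.

Lemma wGamma_mult a (t : hom a (H a)) :
  wGamma t ∘ mu a = mu a ∘ wGamma (wcoact t).
Proof.
rewrite /wGamma compA wcoact_mult (cancel22 _ (epN _)).
by [].
Qed.

Lemma wGammaE a (t : hom a (H a)) :
  wGamma t = mu a ∘ fmap H (xi M G omega a ∘ t).
Proof.
by rewrite /wGamma /wcoact (cancel22 _ (entw_counit W a)) fmapM ?compA.
Qed.

Lemma mult_wGamma a (t : hom a (H a)) :
  mu a ∘ fmap H (wGamma t) = wGamma t ∘ mu a.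
Proof.
rewrite !wGammaE fmapM (cancel22 _ (multA M a)) !compA.
by rewrite mN.
Qed.

Lemma wGamma_unit a (t : hom a (H a)) :
  wGamma t ∘ et a = xi M G omega a ∘ t.
Proof.
rewrite wGammaE compA -eN -compA mult1m; exact: comp1m.
Qed.

Lemma co_coassoc (x : comodule_ob G) : coassoc (co x).
Proof. by case: (comoduleP x). Qed.

Lemma GammaE (x : comodule_ob G) : Gam x = wGamma (co x).
Proof. by []. Qed.

Lemma Gamma_idem (x : comodule_ob G) : Gam x ∘ Gam x = Gam x.
Proof. by rewrite GammaE wGamma_idem //; apply: co_coassoc. Qed.

Lemma Gamma_splitting_exists :
  cauchy_complete A -> inhabited (Gamma_splitting G omega).
Proof.
move=> cA.
have sp x : {b : A & {p : hom (H (U x)) b &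
    {i : hom b (H (U x)) | i ∘ p = Gam x /\ p ∘ i = idm b}}}.
  case: (constructive_indefinite_description _ (cA _ _ (Gamma_idem x))).
  move=> b /constructive_indefinite_description[p].
  by move=> /constructive_indefinite_description[i ip]; exists b, p, i.
split; exists (fun x => projT1 (sp x)) (fun x => projT1 (projT2 (sp x)))
  (fun x => proj1_sig (projT2 (projT2 (sp x)))) => x.
- by case: (proj2_sig (projT2 (projT2 (sp x)))).
- by case: (proj2_sig (projT2 (projT2 (sp x)))).
Qed.

Context (S : Gamma_splitting G omega).

Local Notation p := (spl_p S).
Local Notation i := (spl_i S).

Lemma Gamma_i x : Gam x ∘ i x = i x.
Proof. by rewrite -(spl_ip S) ?compA spl_pi compm1. Qed.

Lemma p_Gamma x : p x ∘ Gam x = p x.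
Proof. by rewrite -(spl_ip S) -compA spl_pi comp1m. Qed.

Lemma i_inj x a (f g : hom a (spl_ob S x)) : i x ∘ f = i x ∘ g -> f = g.
Proof.
by move=> eq; rewrite -(comp1m f) -(comp1m g) -(spl_pi S x) !compA eq.
Qed.

Lemma Hi_inj x a (f g : hom a (H (spl_ob S x))) :
  fmap H (i x) ∘ f = fmap H (i x) ∘ g -> f = g.
Proof.
move=> eq; rewrite -(comp1m f) -(comp1m g) -(fmap1 H) -(spl_pi S x) fmapM.
by rewrite !compA eq.
Qed.

Definition T_coaction (x : comodule_ob G) : hom (spl_ob S x) (H (spl_ob S x)) :=
  fmap H (p x) ∘ omega (U x) ∘ fmap H (co x) ∘ i x.

Lemma T_coactionE x : T_coaction x = fmap H (p x) ∘ wcoact (co x) ∘ i x.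
Proof. by rewrite /T_coaction /wcoact !compA. Qed.

Lemma i_comodule_hom x : is_comodule_hom (T_coaction x) (wcoact (co x)) (i x).
Proof.
rewrite /is_comodule_hom T_coactionE fmapMw spl_ip.
by rewrite GammaE (cancel21 _ (wGamma_wcoact (co_coassoc x))).
Qed.

Lemma p_comodule_hom x : is_comodule_hom (wcoact (co x)) (T_coaction x) (p x).
Proof.
rewrite /is_comodule_hom T_coactionE 2!compA spl_ip GammaE.
by rewrite wcoact_wGamma //; apply: co_coassoc.
Qed.

Lemma T_coactionP x : is_comodule G (T_coaction x).
Proof.
split.
  rewrite {2}T_coactionE fmapMw p_comodule_hom fmapM.
  rewrite compA (cancel22 _ (wcoact_coassoc (co_coassoc x))).
  by rewrite -(cancel22 _ (dN _)) -T_coactionE.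
rewrite T_coactionE (cancel22 _ (epN _)).
have e : ep _ ∘ wcoact (co x) ∘ i x = i x.
  by rewrite -{2}Gamma_i -compA.
by rewrite e spl_pi.
Qed.

Definition T_ob (x : comodule_ob G) : comodule_ob G :=
  mk_comodule (spl_ob S x) (T_coaction x) (T_coactionP x).

Definition T_map (x y : comodule_ob G) (f : comodule_hom x y) :
    hom (spl_ob S x) (spl_ob S y) :=
  p y ∘ fmap H (proj1_sig f) ∘ i x.

Lemma Gamma_nat x y (f : comodule_hom x y) :
  Gam y ∘ fmap H (proj1_sig f) = fmap H (proj1_sig f) ∘ Gam x.
Proof. exact: wGammaM (proj2_sig f). Qed.

Lemma i_nat x y (f : comodule_hom x y) :
  i y ∘ T_map f = fmap H (proj1_sig f) ∘ i x.
Proof.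
rewrite /T_map (cancel21 _ (spl_ip S y)) (cancel22 _ (Gamma_nat f)).
by rewrite Gamma_i.
Qed.

Lemma p_nat x y (f : comodule_hom x y) :
  T_map f ∘ p x = p y ∘ fmap H (proj1_sig f).
Proof.
by rewrite /T_map !compA spl_ip -Gamma_nat (cancel21 _ (p_Gamma _)).
Qed.

Lemma T_map_comodule_hom x y (f : comodule_hom x y) :
  is_comodule_hom (T_coaction x) (T_coaction y) (T_map f).
Proof.
apply: Hi_inj; rewrite (cancel21 _ (eq_sym (i_comodule_hom y))) compA i_nat.
rewrite (cancel22 _ (wcoactM (proj2_sig f))) i_comodule_hom.
by rewrite (fmapMw (i y) (T_map f)) i_nat fmapM compA.
Qed.

Lemma T_map1 x : T_map (@idm (comodules G) x) = idm (spl_ob S x).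
Proof. by apply: i_inj; rewrite i_nat /= fmap1 comp1m compm1. Qed.

Lemma T_mapM (x y z : comodules G) (g : hom y z) (f : hom x y) :
  T_map (g ∘ f) = T_map g ∘ T_map f.
Proof.
apply: i_inj; rewrite i_nat /=.
by rewrite fmapM (cancel22 _ (i_nat g)) i_nat compA.
Qed.

Definition T_functor : functor (comodules G) (comodules G).
Proof.
refine (@Functor (comodules G) (comodules G) T_ob
  (fun x y f => exist _ (T_map f) (T_map_comodule_hom f)) _ _).
- abstract (by move=> x; apply: sig_hom_eq; apply: T_map1).
- abstract (by move=> x y z g f; apply: sig_hom_eq; apply: T_mapM).
Defined.

Definition T_mult (x : comodule_ob G) :
    hom (spl_ob S (T_ob x)) (spl_ob S x) :=
  p x ∘ mu (U x) ∘ fmap H (i x) ∘ i (T_ob x).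

Lemma mult_i_Gamma x :
  Gam x ∘ mu (U x) ∘ fmap H (i x) =
  mu (U x) ∘ fmap H (i x) ∘ Gam (T_ob x).
Proof.
rewrite (cancel22 _ (wGamma_mult (co x))).
by rewrite (wGammaM (i_comodule_hom x)).
Qed.

Lemma i_mult x :
  i x ∘ T_mult x = mu (U x) ∘ fmap H (i x) ∘ i (T_ob x).
Proof.
rewrite /T_mult (cancel21 _ (spl_ip S x)).
have e := cancel22 (i (T_ob x)) (mult_i_Gamma x).
by move: e; rewrite (compA (mu _)) (compA (fmap H _)) Gamma_i.
Qed.

Lemma T_mult_p x :
  T_mult x ∘ p (T_ob x) = p x ∘ mu (U x) ∘ fmap H (i x).
Proof.
by rewrite /T_mult !compA spl_ip -mult_i_Gamma (cancel21 _ (p_Gamma _)).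
Qed.

Lemma T_mult_pp x :
  T_mult x ∘ p (T_ob x) ∘ fmap H (p x) = p x ∘ mu (U x).
Proof.
rewrite -compA T_mult_p !compA -fmapM spl_ip GammaE mult_wGamma.
by rewrite (cancel21 _ (p_Gamma _)).
Qed.

Lemma T_mult_comodule_hom x :
  is_comodule_hom (T_coaction (T_ob x)) (T_coaction x) (T_mult x).
Proof.
apply: Hi_inj; rewrite (cancel21 _ (eq_sym (i_comodule_hom x))) compA i_mult.
rewrite (cancel22 _ (wcoact_mult (co x))).
rewrite (cancel22 _ (wcoactM (i_comodule_hom x))).
rewrite (i_comodule_hom (T_ob x)) (fmapMw (i x) (T_mult x)) i_mult.
by rewrite !fmapM !compA.
Qed.

Lemma T_mult_nat x y (f : comodule_hom x y) :
  T_mult y ∘ T_map (fmap T_functor (f : @hom (comodules G) x y)) =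
  T_map f ∘ T_mult x.
Proof.
apply: i_inj.
rewrite (cancel21 _ (i_mult y)) (cancel22 _ (i_nat f)) i_mult !compA.
rewrite i_nat /= (fmapMw (i y) (T_map f)) i_nat fmapM.
by rewrite compA (cancel22 _ (mN _)).
Qed.

Definition T_mult_trans : nat_trans (T_functor ⊙ T_functor) T_functor.
Proof.
refine (@NatTrans _ _ (T_functor ⊙ T_functor) T_functor
  (fun x => exist _ (T_mult x) (T_mult_comodule_hom x)) _).
abstract (by move=> x y f; apply: sig_hom_eq; apply: T_mult_nat).
Defined.

(* [coaction x] also has target [H x], but [p x ∘ coaction x] is not a unit for
   [T_mult] in general: for an ordinary entwining [Gamma] is the identity, and
   the unit law would say [mult a ∘ fmap H (coaction x) = idm (H a)].  By
   [monad_unit_unique] the unit below is the only one compatible with [T_mult];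
   it also equals [p x ∘ xi ∘ coaction x], see [T_unit_xi]. *)
Definition T_unit (x : comodule_ob G) : hom (U x) (spl_ob S x) :=
  p x ∘ et (U x).

Lemma i_unit x : i x ∘ T_unit x = Gam x ∘ et (U x).
Proof. by rewrite /T_unit (cancel21 _ (spl_ip S x)). Qed.

Lemma T_unit_xi x : T_unit x = p x ∘ xi M G omega (U x) ∘ co x.
Proof. by rewrite /T_unit -{1}p_Gamma compA GammaE wGamma_unit. Qed.

Lemma T_unit_comodule_hom x :
  is_comodule_hom (co x) (T_coaction x) (T_unit x).
Proof.
rewrite /is_comodule_hom {1}/T_unit (cancel22 _ (p_comodule_hom x)).
rewrite /wcoact compA -eN (cancel22 _ (entw_unit W _)).
have /= <- := co_coassoc x.
by rewrite T_unit_xi !fmapM !compA.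
Qed.

Lemma T_unit_nat x y (f : comodule_hom x y) :
  T_unit y ∘ proj1_sig f = T_map f ∘ T_unit x.
Proof. by rewrite /T_unit (cancel21 _ (p_nat f)) !compA eN. Qed.

Definition T_unit_trans : nat_trans (id_functor (comodules G)) T_functor.
Proof.
refine (@NatTrans _ _ (id_functor (comodules G)) T_functor
  (fun x => exist _ (T_unit x) (T_unit_comodule_hom x)) _).
abstract (by move=> x y f; apply: sig_hom_eq; apply: T_unit_nat).
Defined.

Lemma T_multA (x : comodules G) :
  T_mult_trans x ∘ fmap T_functor (T_mult_trans x) =
  T_mult_trans x ∘ T_mult_trans (T_functor x).
Proof.
apply: sig_hom_eq; apply: i_inj => /=.
rewrite 2!(cancel21 _ (i_mult x)) 2!(compA (mu _)) 2!(compA (fmap H (i x))).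
rewrite i_nat i_mult /= (fmapMw (i x)) i_mult.
rewrite !fmapM !compA (cancel22 _ (multA M _)).
by rewrite (cancel22 _ (mN (i x))).
Qed.

Lemma T_mult1m (x : comodules G) :
  T_mult_trans x ∘ T_unit_trans (T_functor x) = idm (T_functor x).
Proof.
apply: sig_hom_eq; apply: i_inj => /=.
rewrite (cancel21 _ (i_mult x)) (compA (mu _)) (compA (fmap H (i x))).
rewrite (i_unit (T_ob x)).
have /= e := cancel22 (et (spl_ob S x)) (mult_i_Gamma x).
move: e; rewrite (compA (mu _)) (compA (fmap H _)) => <-.
rewrite -(eN (i x)) (cancel21 _ (mult1m M _)) comp1m compm1.
exact: Gamma_i.
Qed.

Lemma T_multm1 (x : comodules G) :
  T_mult_trans x ∘ fmap T_functor (T_unit_trans x) = idm (T_functor x).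
Proof.
apply: sig_hom_eq; apply: i_inj => /=.
rewrite (cancel21 _ (i_mult x)) (compA (mu _)) (compA (fmap H (i x))).
rewrite i_nat /= (fmapMw (i x)) i_unit fmapM compA.
rewrite (cancel22 _ (mult_wGamma (co x))) (cancel21 _ (multm1 M _)).
by rewrite comp1m compm1 -GammaE Gamma_i.
Qed.

Definition induced_monad : monad T_functor :=
  Monad T_multA T_mult1m T_multm1.

End InducedMonad.

(* Main.v *)
(** The mixed law followed by the counit gives [h ∘ Gamma' = h], so the action of
    a mixed bimodule factors through the splitting [p' : H a -> T a].  Hence
    [h |-> h ∘ i'] and [g |-> g ∘ p'] are mutually inverse on actions, and neither
    changes the underlying comodule. *)
Require Import Defs.
From Stdlib Require Import ssreflect.
From Stdlib Require Import ProofIrrelevance FunctionalExtensionality.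
Open Scope cat_scope.

(** * Extensionality for functors, and cancellation of a faithful one *)

Section FunctorEquality.

Set Implicit Arguments.
Unset Strict Implicit.

(* Packing a morphism with its ends lets functors that agree on objects only up
   to a propositional equality be compared without transports. *)
Definition arrow (A : category) (a b : A) (f : hom a b) :
    {ab : A * A & hom (fst ab) (snd ab)} :=
  existT (fun ab : A * A => hom (fst ab) (snd ab)) (a, b) f.

Lemma functor_eq (A B : category) (F F' : functor A B) :
  (forall a b (f : hom a b), arrow (fmap F f) = arrow (fmap F' f)) -> F = F'.
Proof.
case: F F' => [F Ff F1 FM] [F' Ff' F1' FM'] /= eqf.
have eqo : F = F'.
  apply: functional_extensionality => a.
  (* Equal arrows have equal sources, so identities already determine the action on objects. *)
  exact: (f_equal (fun s => fst (projT1 s)) (eqf a a (idm a))).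
move: Ff' F1' FM' eqf; rewrite -eqo => Ff' F1' FM' eqf.
have eqm : Ff = Ff'.
  do 3 (apply: functional_extensionality_dep => ?).
  exact: inj_pair2 (eqf _ _ _).
move: F1' FM' {eqf}; rewrite -eqm => F1' FM'.
by rewrite (proof_irrelevance _ F1' F1) (proof_irrelevance _ FM' FM).
Qed.

(** Serves with [U] a forgetful functor: the images of a morphism become parallel once objects
    agree, and faithfulness then identifies them. *)
Lemma functor_eq_faithful (A B C : category) (U : functor B C)
    (F F' : functor A B) :
  (forall x y (f g : hom x y), fmap U f = fmap U g -> f = g) ->
  (forall a, F a = F' a) -> U ⊙ F = U ⊙ F' -> F = F'.
Proof.
move=> faithU eqo eqU; apply: functor_eq => a b f.
have : arrow (fmap (U ⊙ F) f) = arrow (fmap (U ⊙ F') f) by rewrite eqU.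
move=> /=; move: (fmap F f) (fmap F' f); rewrite -!eqo => u v eUuv.
by rewrite (faithU _ _ u v (inj_pair2 _ _ _ _ _ eUuv)).
Qed.

Lemma comp_functorA (A B C D : category) (K : functor C D) (F : functor B C)
  (L : functor A B) : (K ⊙ F) ⊙ L = K ⊙ (F ⊙ L).
Proof. exact: functor_eq. Qed.

Lemma comp_functor_id (A B : category) (F : functor A B) :
  F ⊙ id_functor A = F.
Proof. exact: functor_eq. Qed.

End FunctorEquality.

Section MixedBimodulesAsModules.

Set Implicit Arguments.
Unset Strict Implicit.

Context (A : category) (H : functor A A) (M : monad H) (G : comonad H).
Context (omega : nat_trans (H ⊙ H) (H ⊙ H)).
Context (W : weak_entwining M G omega) (S : Gamma_splitting G omega).

Local Notation T := (induced_monad W S).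
Local Notation p := (spl_p S).
Local Notation i := (spl_i S).

(** * From mixed bimodules to modules of the induced monad *)

Lemma mixed_action_Gamma (x : mixed_ob M G omega) :
  mix_action x ∘ Gamma omega (mix_comodule x) = mix_action x.
Proof.
(* Naturality of the counit at the action exposes the right-hand side of the mixed law. *)
rewrite /Gamma /= -(cancel22 _ (epN G (mix_action x))).
have := mixedP x; rewrite /is_mixed => <-.
by rewrite (cancel21 _ (comodule_counit (mix_comoduleP x))) comp1m.
Qed.

Lemma mixed_action_ip (x : mixed_ob M G omega) :
  (mix_action x ∘ i (mix_comodule x)) ∘ p (mix_comodule x) = mix_action x.
Proof. by rewrite compA spl_ip mixed_action_Gamma. Qed.

(** The mixed law says exactly that the action is colinear from [wcoact], which need not be
    counital; [i] is colinear into [wcoact]. *)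
Lemma mixed_T_action_comodule_hom (x : mixed_ob M G omega) :
  is_comodule_hom (T_coaction S (mix_comodule x)) (mix_coaction x)
    (mix_action x ∘ i (mix_comodule x)).
Proof.
apply: (is_comodule_homM (s := wcoact omega (mix_coaction x))).
- by rewrite /is_comodule_hom (mixedP x) /wcoact.
- exact: (i_comodule_hom W S (mix_comodule x)).
Qed.

Definition mixed_T_action (x : mixed_ob M G omega) :
    comodule_hom (T_functor W S (mix_comodule x)) (mix_comodule x) :=
  exist _ (mix_action x ∘ i (mix_comodule x)) (mixed_T_action_comodule_hom x).

Lemma mixed_T_actionP (x : mixed_ob M G omega) :
  is_module T (a := mix_comodule x) (mixed_T_action x).
Proof.
case: (mix_moduleP x) => hA h1.
split; apply: sig_hom_eq => /=.
- rewrite 2!compA (i_nat S (mixed_T_action x)) /= fmapM.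
  rewrite (i_mult W S (mix_comodule x)) /=.
  by rewrite compA (cancel22 _ hA).
(* The unit of [T] followed by [i] is the unit of [M] up to [Gamma], which the action absorbs. *)
- rewrite compA; have /= -> := i_unit M S (mix_comodule x).
  by rewrite -compA mixed_action_Gamma.
Qed.

Lemma mixed_hom_T_module (x y : mixed_ob M G omega) (f : mixed_hom x y) :
  is_module_hom (H := T_functor W S) (mixed_T_action x) (mixed_T_action y)
    (fmap (mixed_forget M G omega) (f : @hom (mixed_bimodules M G omega) x y)).
Proof.
apply: sig_hom_eq => /=.
rewrite compA (i_nat S) /=.
by rewrite (cancel22 _ (proj1 (proj2_sig f))).
Qed.

Definition Phi : functor (mixed_bimodules M G omega) (modules T).
Proof.
refine (@Functor (mixed_bimodules M G omega) (modules T)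
  (fun x => mk_module (mix_comodule x : comodules G) (mixed_T_action x) (mixed_T_actionP x))
  (fun x y f => exist _ _ (mixed_hom_T_module f)) _ _).
- abstract (by move=> x; do 2 apply: sig_hom_eq).
- abstract (by move=> x y z g f; do 2 apply: sig_hom_eq).
Defined.

Lemma modules_forget_Phi : modules_forget T ⊙ Phi = mixed_forget M G omega.
Proof. exact: functor_eq. Qed.

(** * From modules of the induced monad back to mixed bimodules *)

Local Notation T_module_action x := (proj1_sig (action x) ∘ p (mod_carrier x)).

Lemma T_module_actionP (x : modules T) : is_module M (T_module_action x).
Proof.
case: x => x g [gA g1] /=.
have {gA} /= gA := f_equal (@proj1_sig _ _) gA.
have {g1} /= g1 := f_equal (@proj1_sig _ _) g1.
split.
(* Naturality of [p] at [g] brings in [T g]; associativity of [g] then replaces it by [T_mult], and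
   [T_mult_pp] turns that into the multiplication of [M]. *)
- rewrite fmapM compA -(cancel22 _ (p_nat S g)).
  by rewrite (cancel22 _ gA) (T_mult_pp W S) compA.
- by rewrite compA.
Qed.

(** Colinearity of [g ∘ p] out of [wcoact], unfolded, is the mixed law. *)
Lemma T_module_mixed (x : modules T) :
  is_mixed omega (T_module_action x) (coaction (mod_carrier x)).
Proof.
have := is_comodule_homM (proj2_sig (action x))
  (p_comodule_hom W S (mod_carrier x)).
by rewrite /is_comodule_hom /is_mixed /wcoact /=.
Qed.

Lemma T_module_hom_mixed (x y : modules T) (f : hom x y) :
  is_module_hom (T_module_action x) (T_module_action y)
    (proj1_sig (proj1_sig f)) /\
  is_comodule_hom (coaction (mod_carrier x)) (coaction (mod_carrier y))
    (proj1_sig (proj1_sig f)).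
Proof.
case: f => f /= ef; split; last exact: proj2_sig.
have {ef} /= ef := f_equal (@proj1_sig _ _) ef.
by rewrite /is_module_hom (cancel22 _ ef) (p_nat S) compA.
Qed.

Definition Psi : functor (modules T) (mixed_bimodules M G omega).
Proof.
refine (@Functor (modules T) (mixed_bimodules M G omega)
  (fun x => mk_mixed _ _ _ (T_module_actionP x) (comoduleP (mod_carrier x))
              (T_module_mixed x))
  (fun x y f => exist _ _ (T_module_hom_mixed f)) _ _).
- abstract (by move=> x; apply: sig_hom_eq).
- abstract (by move=> x y z g f; apply: sig_hom_eq).
Defined.

Lemma mixed_forget_Psi : mixed_forget M G omega ⊙ Psi = modules_forget T.
Proof.
(* [Psi] rebuilds the comodule from its fields, so the records are destructed to make the objects
   coincide. *)
apply: functor_eq => -[[a t ht] g hg] [[b s hs] k hk] f.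
by congr arrow; apply: sig_hom_eq.
Qed.

(** * The two functors are mutually inverse *)

Lemma Psi_Phi_ob (x : mixed_bimodules M G omega) : Psi (Phi x) = x.
Proof.
case: x => a h t hh ht hw /=.
(* The types of these proofs mention the action, so they are generalized before it is rewritten. *)
move: (T_module_actionP _) (T_module_mixed _) => /=.
rewrite (mixed_action_ip (mk_mixed a h t hh ht hw)) => hh' hw'.
by rewrite (proof_irrelevance _ hh' hh) (proof_irrelevance _ hw' hw).
Qed.

Lemma Phi_Psi_ob (x : modules T) : Phi (Psi x) = x.
Proof.
case: x => [[a t ht] g hg] /=.
move: (mixed_T_actionP _).
set g' := mixed_T_action _ => hg'.
have eg : g' = g by apply: sig_hom_eq; rewrite /= compA spl_pi compm1.
move: hg'; rewrite {}/g' in eg *; rewrite eg => hg'.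
by rewrite (proof_irrelevance _ hg' hg).
Qed.

(** Both functors lie over [comodules G] through faithful forgetful functors, so the object
    equalities suffice. *)
Lemma Phi_Psi_inverse : inverse_functors Phi Psi.
Proof.
split.
- apply: (functor_eq_faithful (U := mixed_forget M G omega)).
  + move=> x y f g /(f_equal (@proj1_sig _ _)) e.
    by apply: sig_hom_eq.
  + exact: Psi_Phi_ob.
  + by rewrite -comp_functorA mixed_forget_Psi modules_forget_Phi comp_functor_id.
- apply: (functor_eq_faithful (U := modules_forget T)).
  + by move=> x y f g; apply: sig_hom_eq.
  + exact: Phi_Psi_ob.
  + by rewrite -comp_functorA modules_forget_Phi mixed_forget_Psi comp_functor_id.
Qed.

End MixedBimodulesAsModules.

Theorem theorem5p6 (A : category) (HA : cauchy_complete A) (H : functor A A)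
    (M : monad H) (G : comonad H) (omega : nat_trans (H ⊙ H) (H ⊙ H))
    (W : weak_entwining M G omega) (S : Gamma_splitting G omega) :
  let T := induced_monad W S in
  exists (Phi : functor (mixed_bimodules M G omega) (modules T))
         (Psi : functor (modules T) (mixed_bimodules M G omega)),
    (* (a, h, theta) |-> ((a, theta), h . i'), identity on underlying maps *)
    (forall (a : A) (h : hom (H a) a) (theta : hom a (H a))
        (hh : is_module M h) (ht : is_comodule G theta)
        (hw : is_mixed omega h theta),
      let x : comodules G := mk_comodule a theta ht in
      exists (g : comodule_hom (T_functor W S x) x) (hg : is_module T g),
        proj1_sig g = h ∘ spl_i S x /\
        Phi (mk_mixed a h theta hh ht hw) = mk_module x g hg) /\
    modules_forget T ⊙ Phi = mixed_forget M G omega /\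
    (* ((a, theta), g) |-> (a, g . p', theta), identity on underlying maps *)
    (forall (a : A) (theta : hom a (H a)) (ht : is_comodule G theta),
      let x : comodules G := mk_comodule a theta ht in
      forall (g : comodule_hom (T_functor W S x) x) (hg : is_module T g),
      exists (hh : is_module M (proj1_sig g ∘ spl_p S x))
             (hw : is_mixed omega (proj1_sig g ∘ spl_p S x) theta),
        Psi (mk_module x g hg) =
        mk_mixed a (proj1_sig g ∘ spl_p S x) theta hh ht hw) /\
    mixed_forget M G omega ⊙ Psi = modules_forget T /\
    inverse_functors Phi Psi.
Proof.
move=> T; exists (Phi W S), (Psi W S); split; last split; last split; last split.
- move=> a h theta hh ht hw x.
  exists (mixed_T_action W S (mk_mixed a h theta hh ht hw)).
  by exists (mixed_T_actionP W S (mk_mixed a h theta hh ht hw)).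
- exact: modules_forget_Phi.
- move=> a theta ht x g hg.
  exists (T_module_actionP (mk_module x g hg)).
  by exists (T_module_mixed (mk_module x g hg)).
- exact: mixed_forget_Psi.
- exact: Phi_Psi_inverse.
Qed.
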